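(* Let $H$ be an ideal hypergraph. Then the following statements are equivalent. 1. $H$ is mengerian. 2. For every non-negative integral vector $w\in\mathbb{Z}_{\ge 0}^{V(H)}$: if $\tau^{w}(H)>0$, then there exists an edge $e\in E(H)$ such that $\tau^{w}(H)=\tau^{w-e}(H)+1$.
   Context: A hypergraph $H=(V,E)$ consists of a finite vertex set $V=V(H)$ and a collection $E=E(H)$ of subsets of $V$ (the edges); edges are assumed to be nonempty. Let $A$ be the incidence matrix of $H$, whose columns are the characteristic vectors ($\{0,1\}$-vectors) of the edges, with rows indexed by the vertices. $H$ is ideal if the set covering polyhedron $Q(A)=\{x\in\mathbb{R}^{V}: x\ge 0,\ xA\ge \mathbf{1}\}$ is integral (all its vertices are integral), where $\mathbf 1$ is the all-ones vector. For an integral vector $w$ indexed by $V$, put $\tau^{w}(H)=\min\{\langle w,x\rangle : x\ge 0,\ xA\ge\mathbf{1}\}$ and $\nu^{w}(H)=\max\{\langle y,\mathbf{1}\rangle : y\ge 0,\ Ay\le w\}$; these are equal for $w\ge 0$ by LP duality. In $w-e$, the edge $e$ is identified with its characteristic vector. If $w-e$ has a negative entry, the minimum defining $\tau^{w-e}(H)$ is unbounded below ($-\infty$), so the equality in statement 2 forces $w-e\ge 0$. $H$ is mengerian (has the max-flow min-cut property) if for every non-negative integral vector $w$ both linear programs $\min\{\langle w,x\rangle : x\ge 0,\ xA\ge\mathbf{1}\}$ and $\max\{\langle y,\mathbf{1}\rangle : y\ge 0,\ Ay\le w\}$ have integral optimum solutions. *)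

(* Defs.v *)
From HB Require Import structures.
From mathcomp Require Import all_boot all_order all_algebra.
From mathcomp Require Import all_classical all_reals all_analysis.

Set Implicit Arguments.
Unset Strict Implicit.
Unset Printing Implicit Defensive.

Import Order.TTheory GRing.Theory Num.Theory.

Local Open Scope classical_set_scope.
Local Open Scope ring_scope.

Record hypergraph (V : finType) := Hypergraph {
  edges : {set {set V}};
  edges_nonempty : finset.set0 \notin edges
}.

Section Vectors.
Context {R : numDomainType}.

(* Mathcomp's order is not extended entrywise to matrices. *)
Definition lemx m n (A B : 'M[R]_(m, n)) : Prop := forall i j, A i j <= B i j.

Definition dotp n (c : 'cV[R]_n) (x : 'rV[R]_n) : R := (x *m c) 0 0.

End Vectors.

Definition integral_mx {R : archiNumDomainType} m n (A : 'M[R]_(m, n)) : Prop :=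
  forall i j, A i j \is a Num.int.

(* Coordinates of vectors in R^V are numbered by the enumeration of V. *)
Definition charvec {R : nzRingType} {V : finType} (e : {set V}) : 'cV[R]_#|V| :=
  \col_i (enum_val i \in e)%:R.

Section Covering.
Context (R : realType) {V : finType} (H : hypergraph V).

Definition incidence_mx : 'M[R]_(#|V|, #|edges H|) :=
  \matrix_(i, j) charvec (enum_val j) i 0.

Definition covering_polyhedron : set 'rV[R]_#|V| :=
  [set x | lemx 0 x /\ lemx (const_mx 1) (x *m incidence_mx)].

Definition packing_polyhedron (w : 'cV[R]_#|V|) : set 'cV[R]_#|edges H| :=
  [set y | lemx 0 y /\ lemx (incidence_mx *m y) w].

(* The vertices of a polyhedron are its extreme points. *)
Definition is_vertex n (P : set 'rV[R]_n) (x : 'rV[R]_n) : Prop :=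
  P x /\ forall (y z : 'rV[R]_n) (t : R), P y -> P z -> 0 < t < 1 ->
    x = t *: y + (1 - t) *: z -> y = z.

Definition ideal : Prop :=
  forall x, is_vertex covering_polyhedron x -> integral_mx x.

(* As the edges are nonempty the program is feasible, so the infimum is either
   an attained minimum or -oo. *)
Definition tau (w : 'cV[int]_#|V|) : \bar R :=
  ereal_inf [set (dotp (map_mx intr w) x)%:E | x in covering_polyhedron].

Definition mengerian : Prop :=
  forall w : 'cV[int]_#|V|, lemx 0 w ->
    (exists x, [/\ covering_polyhedron x, integral_mx x &
       forall x', covering_polyhedron x' ->
         dotp (map_mx intr w) x <= dotp (map_mx intr w) x']) /\
    (exists y, [/\ packing_polyhedron (map_mx intr w) y, integral_mx y &
       forall y', packing_polyhedron (map_mx intr w) y' ->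
         dotp y' (const_mx 1) <= dotp y (const_mx 1)]).

End Covering.

(* Main.v *)
(** A packing [y] of [w] of value [tau w] that is integral uses some edge [e],
    and removing one copy of [e] gives a packing of [w - e] of value
    [tau w - 1]; conversely, the edges supplied by the second statement, peeled
    off one at a time, form an integral packing of value [tau w]. The first
    direction needs strong duality, derived here from Farkas' lemma. The second
    needs [tau w] to be an attained natural number: every feasible point is
    dominated by a vertex, and [w] takes natural values at the vertices since
    [H] is ideal, so a vertex of least value is optimal. *)
Require Import Defs.
From mathcomp Require Import all_boot all_order all_algebra.
From mathcomp Require Import all_classical all_reals all_analysis.
From mathcomp Require Import ring lra.

Import Order.TTheory GRing.Theory Num.Theory.

(** * Farkas' lemma and duality for covering programs *)

Section LinearProgramming.
Set Implicit Arguments.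
Unset Strict Implicit.
Local Open Scope ring_scope.
Context {R : realFieldType}.

Lemma lemx0P p n (A : 'M[R]_(p, n)) : lemx 0 A <-> forall i j, 0 <= A i j.
Proof. by split=> A0 i j; have := A0 i j; rewrite (mxE _ _ i j). Qed.

Lemma dotpE n (c : 'cV[R]_n) (x : 'rV[R]_n) : dotp c x = \sum_i x 0 i * c i 0.
Proof. by rewrite /dotp mxE. Qed.

Lemma dotpDr n (c : 'cV[R]_n) (x y : 'rV[R]_n) :
  dotp c (x + y) = dotp c x + dotp c y.
Proof. by rewrite /dotp mulmxDl mxE. Qed.

Lemma dotpZr n (c : 'cV[R]_n) (a : R) (x : 'rV[R]_n) :
  dotp c (a *: x) = a * dotp c x.
Proof. by rewrite /dotp -scalemxAl mxE. Qed.

Lemma dotpNr n (c : 'cV[R]_n) (x : 'rV[R]_n) : dotp c (- x) = - dotp c x.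
Proof. by rewrite /dotp mulNmx mxE. Qed.

Lemma dotpDl n (c d : 'cV[R]_n) (x : 'rV[R]_n) :
  dotp (c + d) x = dotp c x + dotp d x.
Proof. by rewrite /dotp mulmxDr mxE. Qed.

Lemma dotpBl n (c d : 'cV[R]_n) (x : 'rV[R]_n) :
  dotp (c - d) x = dotp c x - dotp d x.
Proof. by rewrite /dotp mulmxBr !mxE. Qed.

Lemma dotp_ge0 n (c : 'cV[R]_n) (x : 'rV[R]_n) :
  lemx 0 c -> lemx 0 x -> 0 <= dotp c x.
Proof.
move=> c0 x0; rewrite dotpE sumr_ge0// => i _.
by have := c0 i 0; have := x0 0 i; rewrite !mxE => ? ?; exact: mulr_ge0.
Qed.

Lemma ler_dotpr n (c : 'cV[R]_n) (x y : 'rV[R]_n) :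
  lemx 0 c -> lemx x y -> dotp c x <= dotp c y.
Proof.
move=> c0 xy; rewrite !dotpE ler_sum// => i _.
by have := c0 i 0; rewrite mxE => ?; exact: ler_wpM2r.
Qed.

Lemma ler_dotpl n (c d : 'cV[R]_n) (x : 'rV[R]_n) :
  lemx 0 x -> lemx c d -> dotp c x <= dotp d x.
Proof.
move=> x0 cd; rewrite !dotpE ler_sum// => i _.
by have := x0 0 i; rewrite mxE => ?; exact: ler_wpM2l.
Qed.

(* Bartl's induction on the number of constraints: if dropping the constraint
   [a] breaks the implication at [x], eliminate [a] by projecting along [x]
   onto its kernel. *)
Lemma farkas n m (M : 'M[R]_(n, m)) (c : 'cV[R]_n) :
  (forall x : 'rV_n, lemx 0 (x *m M) -> 0 <= dotp c x) ->
  exists2 y : 'cV_m, lemx 0 y & c = M *m y.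
Proof.
elim: m M c => [M c Mc|m IH].
  exists 0; first by move=> ? ?; rewrite !mxE.
  rewrite mulmx0; apply/colP => i; rewrite [RHS]mxE.
  have all_nonneg x : 0 <= dotp c x by apply: Mc => ? [].
  have dotp_delta a : dotp c (a *: delta_mx 0 i) = a * c i 0.
    by rewrite dotpZr /dotp -rowE mxE.
  have := all_nonneg (1 *: delta_mx 0 i); have := all_nonneg ((-1) *: delta_mx 0 i).
  by rewrite !dotp_delta; lra.
rewrite -[m.+1]add1n => M c Mc.
rewrite -(hsubmxK M) in Mc; set a := lsubmx _ in Mc; set N := rsubmx _ in Mc.
have [Nc|] := pselect (forall x : 'rV_n, lemx 0 (x *m N) -> 0 <= dotp c x).
  have [y y0 ->] := IH _ _ Nc.
  exists (col_mx 0 y); last by rewrite -[M]hsubmxK mul_row_col mulmx0 add0r.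
  move=> i j; rewrite [X in X <= _]mxE.
  case: (split_ordP i) => k ->; rewrite ?col_mxEu ?col_mxEd; first by rewrite mxE.
  exact: (lemx0P _).1.
move=> /existsNP[x /not_implyP[xN /negP]]; rewrite -ltNge => cx.
have ax : dotp a x < 0.
  rewrite ltNge; apply/negP => ax; have : 0 <= dotp c x; last by rewrite leNgt cx.
  apply: Mc => i j; rewrite [X in X <= _]mxE mul_mx_row (ord1 i).
  case: (split_ordP j) => k ->; rewrite ?row_mxEl ?row_mxEr.
    by rewrite (ord1 k).
  by have := xN 0 k; rewrite mxE.
(* Scaled so that [dotp a u = 1], which makes [z - (z *m a) *m u] the projection of [z] onto the
   kernel of [a]. Dividing by the negative [dotp a x] flips the signs of [dotp c x] and [x *m N]. *)
pose u := (dotp a x)^-1 *: x.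
have au : u *m a = 1%:M.
  apply/matrixP => i j; rewrite !ord1 -[LHS]/(dotp a u) dotpZr mulVf ?mxE//.
  by rewrite lt_eqF.
have cu : 0 <= dotp c u by rewrite dotpZr mulr_le0 ?invr_le0 1?ltW.
have uN k : (u *m N) 0 k <= 0.
  rewrite -scalemxAl mxE; apply: mulr_le0_ge0; first by rewrite invr_le0 ltW.
  by have := xN 0 k; rewrite [X in X <= _]mxE.
have [|y y0 yE] := IH (N - a *m (u *m N)) (c - a *m (u *m c)).
  move=> z zN.
  have -> : dotp (c - a *m (u *m c)) z = dotp c (z - (z *m a) *m u).
    by rewrite /dotp mulmxBl mulmxBr !mulmxA.
  apply: Mc; rewrite mul_mx_row.
  have -> : (z - z *m a *m u) *m a = 0.
    by rewrite mulmxBl -(mulmxA _ u) au mulmx1 subrr.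
  have -> : (z - z *m a *m u) *m N = z *m (N - a *m (u *m N)).
    by rewrite mulmxBl mulmxBr !mulmxA.
  move=> i j; rewrite [X in X <= _]mxE.
  case: (split_ordP j) => k ->; rewrite ?row_mxEl ?row_mxEr; first by rewrite mxE.
  by have := zN i k; rewrite [X in X <= _]mxE.
(* Solving [yE] for [c] yields this multiplier of [a]; it is nonnegative since [u *m c >= 0],
   [u *m N <= 0] and [y >= 0]. *)
exists (col_mx (u *m c - u *m N *m y) y); last first.
  rewrite -[M]hsubmxK mul_row_col -/a -/N mulmxBr.
  move/eqP: yE; rewrite subr_eq => /eqP {1}->.
  by rewrite mulmxBl !mulmxA -addrA [LHS]addrC; congr (_ + _); rewrite addrC.
move=> i j; rewrite [X in X <= _]mxE (ord1 j).
case: (split_ordP i) => k ->; rewrite ?col_mxEu ?col_mxEd; last first.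
  by have := y0 k 0; rewrite mxE.
rewrite (ord1 k) !mxE subr_ge0 (@le_trans _ _ 0)//; last first.
  by move: cu; rewrite dotpE.
apply: sumr_le0 => l _; apply: mulr_le0_ge0; first exact: uN.
by have := y0 l 0; rewrite mxE.
Qed.

Context {n m : nat}.
Implicit Types (M : 'M[R]_(n, m)) (b : 'rV[R]_m) (c : 'cV[R]_n).

Lemma covering_weak_duality M b c (x : 'rV_n) (y : 'cV_m) :
  lemx 0 x -> lemx b (x *m M) -> lemx 0 y -> lemx (M *m y) c ->
  dotp y b <= dotp c x.
Proof.
move=> x0 bx y0 yc; apply: le_trans (ler_dotpl x0 yc).
by rewrite {2}/dotp mulmxA; exact: ler_dotpr.
Qed.

(* Farkas' lemma for the homogenized system [x >= 0], [z >= 0], [xM >= zb]. *)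
Lemma covering_strong_duality M b c (s : R) : lemx 0 c ->
  (forall x : 'rV_n, lemx 0 x -> lemx b (x *m M) -> s <= dotp c x) ->
  exists y : 'cV_m, [/\ lemx 0 y, lemx (M *m y) c & s <= dotp y b].
Proof.
move=> c0 Ms.
(* On [row_mx x z] the column blocks of [N] read [x >= 0] with [z >= 0], then [z >= 0], then
   [xM - zb >= 0]; the functional is [<c, x> - s z]. *)
pose N := row_mx 1%:M (row_mx (delta_mx (rshift n 0) (0 : 'I_1)) (col_mx M (- b))).
have [|y y0 yE] := @farkas (n + 1) ((n + 1) + (1 + m)) N (col_mx c (- s%:M)).
  move=> v; rewrite -[v]hsubmxK; set x := lsubmx _; set z := rsubmx _.
  have -> : row_mx x z *m N = row_mx (row_mx x z) (row_mx z (x *m M - z *m b)).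
    rewrite /N !mul_mx_row mulmx1 mul_row_col mulmxN; congr (row_mx _ (row_mx _ _)).
    by rewrite -colE; apply/matrixP => i j; rewrite [LHS]mxE row_mxEr (ord1 j).
  move=> v0.
  have x0 : lemx 0 x.
    apply/lemx0P => i j; have := (lemx0P _).1 v0 i (lshift _ (lshift _ j)).
    by rewrite !row_mxEl.
  have z0 : 0 <= z 0 0.
    by have := (lemx0P _).1 v0 0 (rshift _ (lshift _ 0)); rewrite row_mxEr row_mxEl.
  have xM i : z 0 0 * b 0 i <= (x *m M) 0 i.
    have := v0 0 (rshift _ (rshift _ i)).
    rewrite !row_mxEr [X in X <= _]mxE [X in _ <= X]mxE [X in _ + X]mxE subr_ge0.
    by rewrite [X in X <= _]mxE big_ord1.
  rewrite /dotp mul_row_col mulmxN mul_mx_scalar mxE [X in _ + X]mxE [X in _ - X]mxE.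
  rewrite subr_ge0.
  (* For [z = 0] the claim is [<c, x> >= 0]; otherwise [x / z] is feasible and [Ms] bounds its
     cost. *)
  have [z_eq0|z_neq0] := eqVneq (z 0 0) 0.
    by rewrite z_eq0 mulr0; exact: dotp_ge0.
  have z_gt0 : 0 < z 0 0 by rewrite lt_neqAle eq_sym z_neq0.
  rewrite -ler_pdivlMr// mulrC -[X in _ * X]/(dotp c x) -dotpZr; apply: Ms.
    apply/lemx0P => i j; rewrite mxE mulr_ge0 ?invr_ge0 ?(ltW z_gt0)//.
    exact: (lemx0P x).1.
  move=> i j; rewrite (ord1 i) -scalemxAl mxE mulrC ler_pdivlMr// mulrC; exact: xM.
have y0' k : 0 <= y k 0 by have := y0 k 0; rewrite mxE.
move: yE; rewrite -[y]vsubmxK; set p := usubmx y; set q := dsubmx y.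
rewrite -[q]vsubmxK; set t := usubmx q; set r := dsubmx q.
rewrite -[p]vsubmxK; set p1 := usubmx p; set p2 := dsubmx p.
rewrite !mul_row_col mul1mx mul_col_mx mulNmx => yE.
have tE : delta_mx (rshift n 0) (0 : 'I_1) *m t = col_mx 0 t.
  apply/matrixP => i j; rewrite mxE big_ord1 mxE eqxx andbT (ord1 j).
  case: (split_ordP i) => k ->; rewrite ?col_mxEu ?col_mxEd.
    by rewrite eq_lrshift mul0r mxE.
  by rewrite (ord1 k) eqxx mul1r.
move: yE; rewrite tE !add_col_mx add0r => /eq_col_mx[cE sE].
(* The multipliers satisfy [c = p1 + M r] and [-s = p2 + t - <r, b>], where [p1], [p2] and [t] are
   nonnegative. *)
exists r; split.
- by move=> i j; rewrite mxE (ord1 j) !mxE.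
- by move=> i j; rewrite cE [X in _ <= X]mxE lerDr (ord1 j) !mxE.
- move/matrixP/(_ 0 0): sE; rewrite !mxE eqxx mulr1n -[\sum_j _]dotpE => sE.
  have := y0' (lshift _ (rshift _ 0)); have := y0' (rshift _ (lshift _ 0)).
  by move: sE; lra.
Qed.

End LinearProgramming.

(** * Vertices of covering polyhedra *)

Section Vertices.
Set Implicit Arguments.
Unset Strict Implicit.
Local Open Scope ring_scope.
Context {R : realType} {n m : nat}.
Implicit Types (M : 'M[R]_(n, m)) (b : 'rV[R]_m) (c : 'cV[R]_n).

Definition slack M b (x : 'rV[R]_n) (k : 'I_n + 'I_m) : R :=
  match k with inl i => x 0 i | inr j => (x *m M) 0 j - b 0 j end.

Lemma slack_ge0 M b x :
  (forall k, 0 <= slack M b x k) <-> lemx 0 x /\ lemx b (x *m M).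
Proof.
split=> [s0|[x0 bx] [i|j]] /=.
- split=> i j; rewrite (ord1 i).
    by rewrite mxE; have := s0 (inl j).
  by have := s0 (inr j); rewrite /= subr_ge0.
- by have := x0 0 i; rewrite mxE.
- by rewrite subr_ge0.
Qed.

Lemma slack_line M b x d u k :
  slack M b (x + u *: d) k = slack M b x k + u * slack M 0 d k.
Proof. by case: k => k /=; rewrite ?mulmxDl -?scalemxAl !mxE ?subr0//; ring. Qed.

(* Starting from a non-extreme point, move along a segment without increasing
   the cost until a new constraint becomes tight; the tight ones stay tight. *)
Lemma vertex_below M b c (x : 'rV_n) : lemx 0 c ->
  lemx 0 x -> lemx b (x *m M) ->
  exists2 v, is_vertex [set x | lemx 0 x /\ lemx b (x *m M)]%classic v &
    dotp c v <= dotp c x.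
Proof.
move=> c0 x0 bx; have {x0 bx} := (slack_ge0 M b x).2 (conj x0 bx).
set P := (X in is_vertex X).
have [N] := ubnP #|[set k | slack M b x k != 0]|.
elim: N x => // N IH x /ltnSE-cardN sx.
have [xV|] := pselect (is_vertex P x); first by exists x.
move=> /not_andP[|]; first by move=> []; exact/slack_ge0.
move=> /existsNP[y /existsNP[z /existsNP[t]]].
move=> /not_implyP[/slack_ge0 Py /not_implyP[/slack_ge0 Pz]].
move=> /not_implyP[/andP[t0 t1] /not_implyP[xE yz]].
(* A direction that keeps tight constraints tight, does not raise the cost, and eventually leaves
   the polyhedron. *)
pose good d := [/\ forall k, slack M b x k = 0 -> slack M 0 d k = 0,
                   dotp c d <= 0 & exists k, slack M 0 d k < 0].
have slackN d k : slack M 0 (- d) k = - slack M 0 d k.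
  by case: k => k /=; rewrite ?mulNmx !mxE; ring.
(* A zero slack at [x] is a combination, with positive weights, of the nonnegative slacks at [y] and
   [z], so both vanish. *)
have tight k : slack M b x k = 0 -> slack M 0 (y - z) k = 0.
  have xz : x = z + t *: (y - z).
    by rewrite xE scalerBr scalerBl scale1r addrCA addrA addrC addrA.
  have := Py k; have := Pz k.
  have {1}-> : y = z + 1 *: (y - z) by rewrite scale1r addrC subrK.
  rewrite xz !slack_line mul1r; move: (slack M b z k) (slack M 0 _ k) => p q p0 pq0 ptq.
  have /eqP : t * (p + q) + (1 - t) * p = 0 by rewrite -[RHS]ptq; ring.
  rewrite paddr_eq0; last 2 first.
  - exact: mulr_ge0 (ltW t0) pq0.
  - by rewrite mulr_ge0// subr_ge0 ltW.
  rewrite !mulf_eq0 subr_eq0 (gt_eqF t0) (gt_eqF t1) /=.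
  by move=> /andP[/eqP pq /eqP p_eq0]; move: pq; rewrite p_eq0 add0r.
(* Take [y - z] or its opposite. A strictly decreasing cost forces a negative coordinate because
   [c >= 0]; at constant cost the sign is chosen to produce one. *)
have [d [dtight dc [k1 dk1]]] : exists d, good d.
  have neg_coord d : dotp c d < 0 -> exists k, slack M 0 d k < 0.
    move=> cd; apply: contrapT => /forallNP dk.
    have : 0 <= dotp c d; last by rewrite leNgt cd.
    apply: dotp_ge0 => // i j; rewrite mxE leNgt (ord1 i); apply/negP.
    by move=> dj; apply: (dk (inl j)).
  have tightN k : slack M b x k = 0 -> slack M 0 (- (y - z)) k = 0.
    by move=> /tight; rewrite slackN => ->; rewrite oppr0.
  have [cd|cd|cd] := ltgtP (dotp c (y - z)) 0.
  - by exists (y - z); split => //; [exact: ltW|exact: neg_coord].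
  - have cd' : dotp c (- (y - z)) < 0 by rewrite dotpNr oppr_lt0.
    by exists (- (y - z)); split => //; [exact: ltW|exact: neg_coord].
  - have /rV0Pn[i] : y - z != 0 by rewrite subr_eq0; apply/eqP.
    rewrite neq_lt => /orP[di|di].
      by exists (y - z); split => //; [rewrite cd|exists (inl i)].
    exists (- (y - z)); split => //; first by rewrite dotpNr cd oppr0.
    by exists (inl i); rewrite slackN /= oppr_lt0.
(* Ratio test: the least ratio is the longest feasible step, and the constraint [k0] attaining it
   becomes tight. *)
pose ratio k := slack M b x k / - slack M 0 d k.
case: (@arg_minP _ _ _ k1 (fun k => slack M 0 d k < 0) ratio dk1) => k0 dk0 k0min.
have u0 : 0 <= ratio k0 by rewrite divr_ge0 ?oppr_ge0// ltW.
pose x' := x + ratio k0 *: d.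
have sx' k : 0 <= slack M b x' k.
  rewrite slack_line; have [dk|dk] := leP 0 (slack M 0 d k).
    by rewrite addr_ge0// mulr_ge0.
  have := k0min _ dk; rewrite [X in _ <= X]/ratio ler_pdivlMr ?oppr_gt0//.
  by rewrite mulrN; lra.
have [|v vV vx'] := IH x' _ sx'; last first.
  exists v => //; apply: le_trans vx' _; rewrite dotpDr dotpZr gerDl.
  exact: mulr_ge0_le0.
apply: leq_trans cardN; apply: proper_card; apply/properP; split.
  apply/fintype.subsetP => k; rewrite !inE; apply: contra => /eqP sk.
  by rewrite slack_line sk (dtight _ sk) mulr0 addr0.
exists k0; rewrite !inE.
  by apply/eqP => /dtight dk0_eq; move: dk0; rewrite dk0_eq ltxx.
rewrite negbK slack_line /ratio invrN mulrN mulNr divfK ?subrr// lt_eqF//.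
Qed.

End Vertices.

(** * The covering polyhedron of a hypergraph and the values of [tau] *)

Section Hypergraphs.
Set Implicit Arguments.
Unset Strict Implicit.
Local Open Scope ring_scope.
Context {R : realType} {V : finType} {H : hypergraph V}.
Implicit Types (w : 'cV[int]_#|V|) (x : 'rV[R]_#|V|).

Lemma map_charvec (e : {set V}) : map_mx intr (charvec e) = charvec e :> 'cV[R]_#|V|.
Proof. by apply/colP => i; rewrite !mxE; case: (_ \in e). Qed.

Lemma incidence_mx_col j :
  incidence_mx R H *m delta_mx j 0 = charvec (enum_val j).
Proof. by rewrite -colE; apply/colP => i; rewrite !mxE. Qed.

Lemma dotp_charvec j x :
  dotp (charvec (enum_val j)) x = (x *m incidence_mx R H) 0 j.
Proof. by rewrite -incidence_mx_col /dotp mulmxA -colE mxE. Qed.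

Lemma charvec_ge0 (e : {set V}) : lemx 0 (charvec e : 'cV[R]_#|V|).
Proof. by apply/lemx0P => i j; rewrite mxE. Qed.

Lemma lemx0_map_intr w : lemx 0 (map_mx intr w : 'cV[R]_#|V|) <-> lemx 0 w.
Proof.
by split=> w0 i j; have := w0 i j; rewrite !mxE ler0z.
Qed.

Lemma covering_translate x x' : covering_polyhedron H x -> lemx 0 x' ->
  covering_polyhedron H (x + x').
Proof.
move=> [x0 x1] x'0; split=> i j.
  by rewrite [X in _ <= X]mxE mxE addr_ge0//; exact: (lemx0P _).1.
rewrite mulmxDl [X in _ <= X]mxE; apply: (le_trans (x1 i j)).
by rewrite lerDl (ord1 i) -dotp_charvec; exact: dotp_ge0 (charvec_ge0 _) x'0.
Qed.

(** Each edge contains a vertex, which alone contributes 1. This feasible point is the start of the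
    ray in [tau_ninfty] and yields a first vertex in [ideal_min]. *)
Lemma covering_ones : covering_polyhedron H (const_mx 1 : 'rV[R]_#|V|).
Proof.
split=> i j; first by rewrite !mxE.
rewrite (ord1 i) -dotp_charvec mxE dotpE.
have /set0Pn[v ve] : enum_val j != finset.set0.
  apply: contraNneq (edges_nonempty H) => <-; exact: enum_valP.
rewrite (bigD1 (enum_rank v))//= !mxE mul1r enum_rankK ve lerDl.
by apply: sumr_ge0 => k _; rewrite !mxE mul1r.
Qed.

Lemma tau_min w x : covering_polyhedron H x ->
  (forall x', covering_polyhedron H x' ->
     dotp (map_mx intr w) x <= dotp (map_mx intr w) x') ->
  tau R H w = (dotp (map_mx intr w) x)%:E.
Proof.
move=> Cx xmin; apply/eqP; rewrite eq_le; apply/andP; split.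
  by apply: ereal_inf_lbound; exists x.
by apply: le_ereal_inf_tmp => _ [x' Cx' <-]; rewrite lee_fin; exact: xmin.
Qed.

(** Raising a coordinate of negative weight preserves feasibility and lowers the cost without
    bound. *)
Lemma tau_ninfty w : ~ lemx 0 w -> tau R H w = -oo%E.
Proof.
move=> /existsNP[i /existsNP[j /negP]]; rewrite mxE (ord1 j) -ltNge => wi.
pose D := dotp (map_mx intr w) (const_mx 1 : 'rV[R]_#|V|).
have below (r : R) : (tau R H w <= r%:E)%E.
  (* With this step the cost becomes [D - |r - D|], which is at most [r]. *)
  pose u : R := `|r - D| / - (w i 0)%:~R.
  have u0 : 0 <= u by rewrite divr_ge0// oppr_ge0 lerz0 ltW.
  have Cx : covering_polyhedron H (const_mx 1 + u *: delta_mx 0 i).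
    apply: covering_translate covering_ones _; apply/lemx0P => k l.
    by rewrite !mxE mulr_ge0.
  apply: ge_ereal_inf; exists (dotp (map_mx intr w) (const_mx 1 + u *: delta_mx 0 i))%:E.
    by exists (const_mx 1 + u *: delta_mx 0 i).
  rewrite lee_fin dotpDr dotpZr -/D /dotp -rowE !mxE /u invrN mulrN mulNr divfK.
    by have := ler_norm (- (r - D)); rewrite normrN; lra.
  by rewrite intr_eq0 lt_eqF.
case tauE : (tau R H w) => [s| |] //.
  by have := below (s - 1); rewrite tauE lee_fin lerBrDr gerDl ler10.
by have := below 0; rewrite tauE.
Qed.

Lemma ideal_min w : ideal R H -> lemx 0 w ->
  exists x, [/\ covering_polyhedron H x, integral_mx x &
    forall x', covering_polyhedron H x' ->
      dotp (map_mx intr w) x <= dotp (map_mx intr w) x'].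
Proof.
move=> H_ideal /lemx0_map_intr w0.
pose c : 'cV[R]_#|V| := map_mx intr w.
pose value k := exists2 v, is_vertex (covering_polyhedron H) v & dotp c v = k%:R.
have below x' : covering_polyhedron H x' -> exists2 k, value k & k%:R <= dotp c x'.
  move=> [x'0 x'1]; have [v vV vx'] := vertex_below w0 x'0 x'1.
  have /natrP[k vk] : dotp c v \is a Num.nat.
    rewrite natrEint dotp_ge0//; last by case: vV => -[].
    rewrite andbT dotpE rpred_sum// => i _; rewrite rpredM//; first exact: H_ideal.
    by rewrite mxE intr_int.
  by exists k; [exists v|rewrite -vk].
have [k0 k0V _] := below _ covering_ones.
have ex_value : exists k, `[< value k >] by exists k0; apply/asboolP.
(* Well-ordering of the naturals picks a cheapest vertex, and [below] compares it with every
   feasible point. *)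
case: (ex_minnP ex_value) => k /asboolP[v vV vk] kmin.
exists v; split; [by case: vV|exact: H_ideal|].
move=> x' /below[k' k'V]; apply: le_trans; rewrite -/c vk ler_nat.
by apply: kmin; apply/asboolP.
Qed.

End Hypergraphs.

(** * Mengerian hypergraphs and edge removal *)

Theorem theorem5p2 (R : realType) (V : finType) (H : hypergraph V)
    (H_ideal : ideal R H) :
  mengerian R H <->
  (forall w : 'cV[int]_#|V|, lemx 0%R w ->
     (0%:E < tau R H w)%E ->
     exists e : {set V}, e \in edges H /\
       tau R H w = (tau R H (w - charvec e)%R + 1%:E)%E).
Proof.
set ones : 'rV[R]_#|edges H| := const_mx 1%R.
have ones0 : lemx 0%R ones by apply/lemx0P => i j; rewrite mxE.
have map_sub w (e : {set V}) :
    map_mx intr (w - charvec e)%R = (map_mx intr w - charvec e)%R :> 'cV[R]_#|V|.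
  by rewrite map_mxB map_charvec.
split=> [men w w0|reduce w w0].
  have [[x [Cx _ xmin]] [y [[y0 yw] y_int ymax]]] := men w w0.
  rewrite (tau_min Cx xmin) lte_fin => x_gt0.
  have y_opt : (dotp (map_mx intr w) x <= dotp y ones)%R.
    have [|z [z0 zw]] := covering_strong_duality (M := incidence_mx R H)
        (b := ones) (s := dotp (map_mx intr w) x) (proj2 (lemx0_map_intr w) w0).
      by move=> x' x'0 x'1; exact: xmin.
    by move=> /le_trans; apply; exact: ymax.
  have [j yj] : exists j, (0 < y j 0)%R.
    apply: contrapT => /forallNP y_le0.
    have : (dotp y ones <= 0)%R.
      rewrite dotpE sumr_le0// => j _; rewrite mxE mul1r leNgt.
      exact/negP/y_le0.
    by rewrite leNgt (lt_le_trans x_gt0 y_opt).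
  (* Integrality turns positivity into room for removing a whole copy of the edge. *)
  have yj1 : (1 <= y j 0)%R.
    by have /intrP[k yk] := y_int j 0%R; move: yj; rewrite yk ltr0z ler1z gtz0_ge1.
  pose y' := (y - delta_mx j 0)%R.
  have y'0 : lemx 0%R y'.
    apply/lemx0P => i k; rewrite (ord1 k) mxE [X in (_ + X)%R]mxE mxE andbT.
    have [->|_] := eqVneq i j; first by rewrite subr_ge0.
    by rewrite mulr0n subr0; exact: (lemx0P _).1.
  have y'w : lemx (incidence_mx R H *m y')%R (map_mx intr (w - charvec (enum_val j)))%R.
    move=> i k; rewrite map_sub mulmxBr incidence_mx_col.
    by rewrite [X in (X <= _)%R]mxE [X in (_ <= X)%R]mxE lerD2r; exact: yw.
  (* The weight [w - e] dominates the nonnegative load of [y'], so [men] applies to it. *)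
  have w'0 : lemx 0%R (w - charvec (enum_val j))%R.
    apply/(lemx0_map_intr (R := R)) => i k; apply: le_trans (y'w i k).
    rewrite mxE mxE sumr_ge0// => l _.
    by rewrite mulr_ge0//; [rewrite !mxE|exact: (lemx0P _).1].
  have [[x' [Cx' _ x'min]] _] := men _ w'0.
  exists (enum_val j); split; first exact: enum_valP.
  rewrite (tau_min Cx' x'min) -EFinD; congr (_%:E); apply/eqP.
  (* Since [x] covers [e], its cost for [w - e] is at most [tau w - 1]; weak duality with [y'] gives
     the reverse bound. *)
  have := x'min _ Cx; rewrite {2}map_sub dotpBl dotp_charvec.
  have := covering_weak_duality (proj1 Cx') (proj2 Cx') y'0 y'w.
  rewrite dotpBl.
  have -> : dotp (delta_mx j 0%R) ones = 1%R.
    by rewrite /dotp -colE !mxE.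
  have := proj2 Cx 0%R j; rewrite [X in (X <= _)%R]mxE.
  by move: y_opt => *; rewrite eq_le; apply/andP; split; lra.
have [x [Cx x_int xmin]] := ideal_min H_ideal w0; split; first by exists x.
(* By weak duality, an integral packing reaching the cost of [x] is optimal. *)
suff [y [Cy y_int xy]] : exists y, [/\ packing_polyhedron (H := H) (map_mx intr w) y,
    integral_mx y & (dotp (map_mx intr w) x <= dotp y ones)%R].
  exists y; split=> // y' [y'0 y'w]; apply: le_trans xy.
  exact: covering_weak_duality (proj1 Cx) (proj2 Cx) y'0 y'w.
have /natrP[k wx] : (dotp (map_mx intr w) x : R) \is a Num.nat.
  rewrite natrEint (dotp_ge0 (proj2 (lemx0_map_intr w) w0) (proj1 Cx)) andbT.
  by rewrite dotpE rpred_sum// => i _; rewrite rpredM// mxE intr_int.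
elim: k w w0 x Cx x_int xmin wx => [|k IH] w w0 x Cx x_int xmin wx.
  exists 0%R; split.
  - split; first by apply/lemx0P => i j; rewrite mxE.
    by rewrite mulmx0; apply/lemx0_map_intr.
  - by move=> i j; rewrite mxE rpred0.
  - by rewrite wx dotp_ge0//; apply/lemx0P => i j; rewrite mxE.
have [|e [eH tau_e]] := reduce w w0.
  by rewrite (tau_min Cx xmin) lte_fin wx ltr0n.
(* Otherwise [tau (w - e)] would be [-oo], while [tau w] is finite. *)
have w'0 : lemx 0%R (w - charvec e)%R.
  apply: contrapT => /(tau_ninfty (R := R) (H := H)) tau'.
  by move: tau_e; rewrite tau' (tau_min Cx xmin).
have [x' [Cx' x'_int x'min]] := ideal_min H_ideal w'0.
move: tau_e; rewrite (tau_min Cx xmin) (tau_min Cx' x'min) wx -EFinD => -[].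
rewrite -natr1 => /addIr/esym wx'.
have [y [[y0 yw] y_int yk]] := IH _ w'0 _ Cx' x'_int x'min wx'.
pose j := enum_rank_in eH e.
have ej : enum_val j = e by rewrite enum_rankK_in.
(* Adding one copy of [e] to the packing of [w - e] loads exactly the weight that was subtracted. *)
exists (y + delta_mx j 0)%R; split.
- split.
    apply/lemx0P => i l; rewrite mxE addr_ge0//; first exact: (lemx0P _).1.
    by rewrite mxE.
  move=> i l; rewrite mulmxDr incidence_mx_col ej [X in (X <= _)%R]mxE.
  have := yw i l; rewrite map_sub [X in (_ <= X)%R]mxE [X in (_ + X)%R]mxE.
  by rewrite lerBrDr.
- by move=> i l; rewrite mxE rpredD// mxE rpred_nat.
- rewrite dotpDl -wx'.
  have -> : dotp (delta_mx j 0%R) ones = 1%R.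
    by rewrite /dotp -colE !mxE.
  by rewrite lerD2r.
Qed.
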